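(* Let $N\ge1$ and $M\ge1$ be integers and let $d_1,\dots,d_M\ge0$ be real numbers. Let $y_1,\dots,y_M$ be independent random vectors in the Euclidean space $\mathbb{R}^N$ such that $y_i$ is uniformly distributed on the sphere of radius $d_i$ centered at the origin, and let $y=y_1+\cdots+y_M$. Then $$\mathbb{E}\left[\Vert y\Vert^2\right]=d_1^2+d_2^2+\cdots+d_M^2 ,$$ and the standard deviation $\sigma$ of the random variable $\Vert y\Vert^2$ satisfies $$\sigma^2=\frac4N\sum_{1\le i<j\le M}d_i^2d_j^2 .$$
   Context: $\|\cdot\|$ is the Euclidean norm on $\mathbb{R}^N$. ''Uniformly distributed on the sphere of radius $d$ centered at the origin'' means distributed as $d\cdot w$ with $w$ distributed according to the rotation-invariant probability measure on the unit sphere $S^{N-1}\subset\mathbb{R}^N$ (for $N=1$, the uniform measure on $\{1,-1\}$). *)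

(* Defs.v *)
From HB Require Import structures.
From mathcomp Require Import all_boot all_order all_algebra.
From mathcomp Require Import all_classical all_reals all_analysis.

Set Implicit Arguments.
Unset Strict Implicit.
Unset Printing Implicit Defensive.

Import Order.TTheory GRing.Theory Num.Theory.
Import numFieldNormedType.Exports.

Local Open Scope classical_set_scope.
Local Open Scope ring_scope.

(* R^N is 'rV[R]_N with its Borel sigma-algebra. *)
HB.instance Definition _ (R : realType) (m n : nat) :=
  @isMeasurable.Build (sigma_display (@open 'M[R]_(m, n))) 'M[R]_(m, n)
    <<s (@open 'M[R]_(m, n)) >> (@sigma_algebra0 _ setT _)
    (@sigma_algebraC _ _) (@sigma_algebra_bigcup _ setT _).

(* The library norm `|v| on 'rV[R]_N is the sup norm, not the Euclidean one. *)
Definition enorm (R : realType) (N : nat) (v : 'rV[R]_N) : R :=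
  Num.sqrt (\sum_(k < N) v ord0 k ^+ 2).

Definition unit_sphere (R : realType) (N : nat) : set 'rV[R]_N :=
  [set w | enorm w = 1].
Arguments unit_sphere : clear implicits.

(* Invariance is required under all of O(N), not just SO(N): for N >= 2 the
   invariant probability measure on the sphere is the same, and for N = 1, where
   SO(1) is trivial, O(1) = {1, -1} singles out the uniform measure on {1, -1}. *)
Definition is_uniform_unit_sphere (R : realType) (N : nat)
    (mu : probability 'rV[R]_N R) : Prop :=
  mu (unit_sphere R N) = 1%E /\
  forall Q : 'M[R]_N, Q *m Q^T = 1%:M ->
    forall A : set 'rV[R]_N, measurable A ->
      mu ((fun w : 'rV[R]_N => w *m Q) @^-1` A) = mu A.

Definition uniform_on_sphere d (T : measurableType d) (R : realType)
    (P : probability T R) (N : nat) (r : R) (X : {RV P >-> 'rV[R]_N}) : Prop :=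
  exists2 mu : probability 'rV[R]_N R, is_uniform_unit_sphere mu &
    forall A : set 'rV[R]_N, measurable A ->
      distribution P X A = mu ((fun w : 'rV[R]_N => r *: w) @^-1` A).

Definition mutually_independent d (T : measurableType d) (R : realType)
    (P : probability T R) d' (T' : measurableType d') (I : finType)
    (X : I -> {RV P >-> T'}) : Prop :=
  forall (J : {set I}) (B : I -> set T'), (forall i, measurable (B i)) ->
    P (\bigcap_(i in [set` J]) (X i @^-1` B i)) =
    (\prod_(i in J) P (X i @^-1` B i))%E.

Definition stdev d (T : measurableType d) (R : realType)
    (P : probability T R) (Z : T -> R) : \bar R := sqrte 'V_P[Z].

(* Main.v *)
Require Import Defs.
From HB Require Import structures.
From mathcomp Require Import all_boot all_order all_algebra.
From mathcomp Require Import all_classical all_reals all_analysis.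
From mathcomp Require Import finmap fingroup perm measurable_realfun.
From mathcomp Require Import ring lra.

(** The vectors are added one at a time. If [S] is the sum of the vectors
already added and [x] is the next one, uniform on the sphere of radius [r], then
[|x + S|^2 = r^2 + |S|^2 + 2 <x, S>]. Because [x] is independent of [S] and its
law is invariant under orthogonal maps, [x] has mean 0 and covariance
[r^2 / N] times the identity. Hence [<x, S>] has mean 0, is uncorrelated with
every bounded function of the earlier vectors, and has second moment
[(r^2 / N) E |S|^2]. By induction [|S|^2] has mean [q], the sum of the squared
radii used so far, and each step increases its variance by [4 (r^2 / N) q]. So
the variance is [(2 / N) (q^2 - sum of the fourth powers of the radii)], that is
[(4 / N)] times the sum of [d_i^2 d_j^2] over pairs [i < j]. This induction is
[excess_moments].

Two technical points carry the probability. First, a uniform vector lies on its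
sphere only almost surely; its coordinates are replaced by [sphcoord], which are
almost surely equal to them and bounded everywhere, with sum of squares exactly
[r^2]. Coordinate reflections and transpositions then give [mean_sphcoord],
[mean_sphcoordM_neq] and [mean_sphcoord_sq]. Second, independence is given
only as a product rule for events. [mean_mul_of_indic] turns a product rule for
indicators into one for bounded functions, [mean_prod] extends it to all factors
of a product, and [mean_indep_prod_span] to polynomial expressions in the
earlier vectors, which is the form of independence used in the induction. *)

Set Implicit Arguments.
Unset Strict Implicit.
Unset Printing Implicit Defensive.

Import Order.TTheory GRing.Theory Num.Theory.
Import numFieldNormedType.Exports.
Import HBNNSimple.

Local Open Scope classical_set_scope.
Local Open Scope ring_scope.

(** * Bounded measurable functions and their mean *)

(** The class is closed under sums and products and its members are integrable
for every probability, so polynomial computations under the mean need no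
integrability side conditions. *)
Definition bmeas {d} {T : measurableType d} {R : realType} (f : T -> R) :=
  measurable_fun setT f /\ exists C : R, forall x, `|f x| <= C.

Section BoundedMeasurable.
Context {d} {T : measurableType d} {R : realType}.
Implicit Types f g : T -> R.

Lemma bmeas_cst (c : R) : bmeas (fun _ : T => c).
Proof. by split; [exact: measurable_cst | exists `|c|]. Qed.

Lemma bmeasD f g : bmeas f -> bmeas g -> bmeas (fun x => f x + g x).
Proof.
move=> [mf [C fC]] [mg [D gD]]; split; first exact: measurable_funD.
by exists (C + D) => x; rewrite (le_trans (ler_normD _ _))// lerD.
Qed.

Lemma bmeasM f g : bmeas f -> bmeas g -> bmeas (fun x => f x * g x).
Proof.
move=> [mf [C fC]] [mg [D gD]]; split; first exact: measurable_funM.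
by exists (C * D) => x; rewrite normrM ler_pM.
Qed.

Lemma bmeasZ (c : R) f : bmeas f -> bmeas (fun x => c * f x).
Proof. by move=> bf; apply: bmeasM => //; exact: bmeas_cst. Qed.

Lemma bmeas_sum (J : Type) (s : seq J) (Q : pred J) (F : J -> T -> R) :
  (forall j, Q j -> bmeas (F j)) ->
  bmeas (fun x => \sum_(j <- s | Q j) F j x).
Proof.
move=> bF; elim: s => [|j s IH].
  have -> : (fun x => \sum_(j <- [::] | Q j) F j x) = fun=> 0.
    by apply/funext => x; rewrite big_nil.
  exact: bmeas_cst.
have -> : (fun x => \sum_(j <- j :: s | Q j) F j x) =
    fun x => (if Q j then F j x else 0) + \sum_(j <- s | Q j) F j x.
  by apply/funext => x; rewrite big_cons; case: ifP; rewrite ?add0r.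
by apply: bmeasD IH; case: (boolP (Q j)) => [/bF//|_]; exact: bmeas_cst.
Qed.

Lemma bmeas_prod (J : Type) (s : seq J) (Q : pred J) (F : J -> T -> R) :
  (forall j, Q j -> bmeas (F j)) ->
  bmeas (fun x => \prod_(j <- s | Q j) F j x).
Proof.
move=> bF; elim: s => [|j s IH].
  have -> : (fun x => \prod_(j <- [::] | Q j) F j x) = fun=> 1.
    by apply/funext => x; rewrite big_nil.
  exact: bmeas_cst.
have -> : (fun x => \prod_(j <- j :: s | Q j) F j x) =
    fun x => (if Q j then F j x else 1) * \prod_(j <- s | Q j) F j x.
  by apply/funext => x; rewrite big_cons; case: ifP; rewrite ?mul1r.
by apply: bmeasM IH; case: (boolP (Q j)) => [/bF//|_]; exact: bmeas_cst.
Qed.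

Lemma bmeas_indic (A : set T) : measurable A -> bmeas (\1_A : T -> R).
Proof.
move=> mA; split; first exact: measurable_indic.
by exists 1 => x; rewrite indicE; case: (_ \in _); rewrite ?normr1 ?normr0.
Qed.

Lemma bmeas_comp {d'} {T' : measurableType d'} (g : T' -> R) (h : T -> T') :
  bmeas g -> measurable_fun setT h -> bmeas (fun x => g (h x)).
Proof.
move=> [mg [C gC]] mh; split; last by exists C.
exact: (measurableT_comp mg mh).
Qed.

Lemma bmeas_measurable f : bmeas f -> measurable_fun setT f.
Proof. by case. Qed.

End BoundedMeasurable.

Section Mean.
Context {d} {T : measurableType d} {R : realType} (P : probability T R).
Implicit Types f g : T -> R.

Definition mean f := (\int[P]_x f x)%R.

Lemma bmeas_integrable f : bmeas f -> P.-integrable setT (EFin \o f).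
Proof.
move=> [mf [C fC]]; apply: measurable_bounded_integrable => //.
  by rewrite (le_lt_trans (probability_le1 _ _))// ltry.
exists C; split; first exact: num_real.
by move=> D CD x _; exact: le_trans (fC x) (ltW CD).
Qed.

Lemma integral_mean f : bmeas f -> (\int[P]_x (f x)%:E = (mean f)%:E)%E.
Proof.
move=> bf; rewrite /mean /Rintegral fineK//.
exact/integrable_fin_num/bmeas_integrable.
Qed.

Lemma mean_cst c : mean (fun _ => c) = c.
Proof.
rewrite /mean Rintegral_cst// -[RHS]mulr1; congr (_ * _).
exact: (congr1 fine (probability_setT P)).
Qed.

Lemma meanD f g : bmeas f -> bmeas g ->
  mean (fun x => f x + g x) = mean f + mean g.
Proof.
by move=> bf bg; rewrite /mean RintegralD//; exact: bmeas_integrable.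
Qed.

Lemma meanZ c f : bmeas f -> mean (fun x => c * f x) = c * mean f.
Proof.
by move=> bf; rewrite /mean RintegralZl//; exact: bmeas_integrable.
Qed.

Lemma mean_sum (J : Type) (s : seq J) (F : J -> T -> R) :
  (forall j, bmeas (F j)) ->
  mean (fun x => \sum_(j <- s) F j x) = \sum_(j <- s) mean (F j).
Proof.
move=> bF; elim: s => [|j s IH].
  rewrite big_nil -[RHS]mean_cst; congr mean.
  by apply/funext => x; rewrite big_nil.
rewrite big_cons -IH -meanD//; last exact: bmeas_sum.
by congr mean; apply/funext => x; rewrite big_cons.
Qed.

Lemma mean_indic (A : set T) : measurable A ->
  mean (\1_A : T -> R) = fine (P A).
Proof. by move=> mA; rewrite /mean /Rintegral integral_indic// setIT. Qed.

Lemma ae_eq_mean f g : measurable_fun setT f -> measurable_fun setT g ->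
  {ae P, forall x, f x = g x} -> mean f = mean g.
Proof.
move=> mf mg fg; rewrite /mean /Rintegral; congr fine.
apply: ae_eq_integral => //; [exact/measurable_EFinP..|].
by apply: filterS fg => x fgx _ /=; rewrite fgx.
Qed.

(** Dominated convergence: a constant is an integrable dominator. *)
Lemma cvg_mean (g_ : nat -> T -> R) f C :
  (forall n, measurable_fun setT (g_ n)) -> measurable_fun setT f ->
  (forall n x, `|g_ n x| <= C) -> (forall x, g_ ^~ x @ \oo --> f x) ->
  mean (g_ n) @[n --> \oo] --> mean f.
Proof.
move=> mg mf gC gf.
have iC := @bmeas_integrable (fun=> C) (bmeas_cst C).
have mgE n : measurable_fun setT (EFin \o g_ n) by exact/measurable_EFinP.
have mfE : measurable_fun setT (EFin \o f) by exact/measurable_EFinP.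
have gfE : {ae P, forall x, setT x ->
    (fun n => (EFin \o g_ n) x) @ \oo --> (EFin \o f) x}.
  by apply: nearW => x _; apply: cvg_EFin; [exact: nearW | exact: gf].
have gCE : {ae P, forall x n, setT x ->
    (`|(EFin \o g_ n) x| <= (EFin \o (fun=> C)) x)%E}.
  by apply: nearW => x n _; rewrite lee_fin.
have [iF _ lim] := dominated_convergence measurableT mgE mfE gfE iC gCE.
by apply: fine_cvg; rewrite fineK//; exact: integrable_fin_num.
Qed.
End Mean.

(** * From indicators to bounded functions *)

Section ProductRule.
Context {d} {T : measurableType d} {R : realType} (P : probability T R).
Implicit Types F W : T -> R.

(** Indicators of events determined by [F] span the simple functions of [F],
and these converge boundedly to [F]; the product rule is linear in its first
factor and passes to the limit. *)
Lemma mean_mul_of_indic F W : bmeas F -> bmeas W ->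
  (forall B, measurable B ->
    mean P (fun x => \1_(F @^-1` B) x * W x) =
    mean P (\1_(F @^-1` B)) * mean P W) ->
  mean P (fun x => F x * W x) = mean P F * mean P W.
Proof.
move=> bF bW FW; have [mF [C FC]] := bF; have [mW [D WD]] := bW.
have FC0 x : 0 <= F x + C.
  by rewrite -lerBlDr sub0r; have := FC x; rewrite ler_norml => /andP[].
(* Simple approximations from below exist for nonnegative functions: they are
   taken for the positive part of [u + C], which at [u = F x] is [F x + C]. *)
pose h u : \bar R := (Num.max (u + C) 0)%:E.
have h0 u : (0 <= h u)%E by rewrite lee_fin le_max lexx orbT.
have mh : measurable_fun setT h.
  apply/measurable_EFinP; apply: measurable_maxr => //.
  exact: measurable_funD.
pose g := nnsfun_approx measurableT mh.
pose G n x := g n (F x).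
have mG n : measurable_fun setT (G n) by apply: (measurableT_comp _ mF).
have cG x : G ^~ x @ \oo --> F x + C.
  have := cvg_nnsfun_approx measurableT mh (fun u _ => h0 u) (x := F x) I.
  by rewrite /h (max_l (FC0 x)) => /fine_cvg.
have GF n x : G n x <= F x + C.
  rewrite -(cvg_lim _ (cG x))//; apply: nondecreasing_cvgn_le; last first.
    by apply/cvg_ex; exists (F x + C); exact: cG.
  by move=> m k mk; have /lefP := nd_nnsfun_approx measurableT mh mk; exact.
have GC n x : `|G n x| <= C + C.
  have G0 : 0 <= G n x by exact: fun_ge0.
  rewrite ger0_norm// (le_trans (GF n x))// lerD2r.
  by have := FC x; rewrite ler_norml => /andP[].
have bG n : bmeas (G n) by split => //; exists (C + C).
have GE n : G n = fun x => \sum_(u <- fset_set (range (g n)))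
    u * \1_(F @^-1` (g n @^-1` [set u])) x.
  by apply/funext => x; rewrite /G fimfunE fsbig_finite.
have bI n u : bmeas (\1_(F @^-1` (g n @^-1` [set u])) : T -> R).
  apply: bmeas_indic; rewrite -[X in measurable X]setTI.
  have mgu : measurable (g n @^-1` [set u]) by exact: measurable_funPTI.
  exact: (mF measurableT).
have GW n : mean P (fun x => G n x * W x) = mean P (G n) * mean P W.
  rewrite GE.
  rewrite mean_sum; last by move=> u; exact: bmeasZ.
  under eq_fun do rewrite mulr_suml.
  rewrite mean_sum; last by move=> u; apply: bmeasM => //; exact: bmeasZ.
  rewrite mulr_suml; apply: eq_bigr => u _.
  under eq_fun do rewrite -mulrA.
  by rewrite meanZ ?FW ?meanZ ?mulrA//; exact: bmeasM.
have cGW : mean P (fun x => G n x * W x) @[n --> \oo] -->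
    mean P (fun x => (F x + C) * W x).
  apply: (@cvg_mean _ _ _ _ _ _ ((C + C) * D)).
  - by move=> n; exact: measurable_funM.
  - by apply: measurable_funM => //; exact: measurable_funD.
  - by move=> n x; rewrite normrM ler_pM.
  - by move=> x; apply: cvgM => //; exact: cvg_cst.
have {}cG : mean P (G n) * mean P W @[n --> \oo] -->
    mean P (fun x => F x + C) * mean P W.
  apply: cvgM; last exact: cvg_cst.
  apply: (@cvg_mean _ _ _ _ _ _ (C + C)) => //.
  exact: measurable_funD.
rewrite (funext GW) in cGW.
have : mean P (fun x => (F x + C) * W x) = mean P (fun x => F x + C) * mean P W.
  exact: cvg_unique cGW cG.
have -> : (fun x => (F x + C) * W x) = fun x => F x * W x + C * W x.
  by apply/funext => x; rewrite mulrDl.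
have bC := @bmeas_cst _ T R C.
rewrite (meanD _ (bmeasM bF bW) (bmeasZ C bW)) (meanD _ bF bC) meanZ// mean_cst.
by rewrite mulrDl => /addIr.
Qed.
End ProductRule.

(** * Expectations of products of independent factors *)

Section Independence.
Context {d} {T : measurableType d} {R : realType} {P : probability T R}.
Context {d'} {T' : measurableType d'} {I : finType} (y : I -> {RV P >-> T'}).
Hypothesis indep : mutually_independent y.

Lemma bmeas_rv (f : T' -> R) (X : {RV P >-> T'}) :
  bmeas f -> bmeas (fun t => f (X t)).
Proof. by move=> bf; apply: bmeas_comp. Qed.

Lemma mean_prod_indic (B : I -> set T') : (forall i, measurable (B i)) ->
  mean P (fun t => \prod_i \1_(B i) (y i t)) =
  \prod_i mean P (fun t => \1_(B i) (y i t)).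
Proof.
move=> mB.
have mI i : measurable (y i @^-1` B i) by exact: measurable_funPTI.
have -> : (fun t => \prod_i \1_(B i) (y i t)) =
    \1_(\bigcap_(i in [set` [set: I]%SET]) (y i @^-1` B i)) :> (T -> R).
  apply/funext => t; rewrite indicE.
  have [yB|yB] := boolP [forall i, y i t \in B i].
    rewrite mem_set; last first.
      by move=> i _; exact: set_mem (forallP yB i).
    by rewrite big1// => i _; rewrite indicE (forallP yB).
  have [i yBi] := forallPn yB.
  rewrite memNset; last first.
    move=> /(_ i) /=; rewrite finset.in_setT => /(_ isT) yBt.
    by rewrite mem_set in yBi.
  by rewrite (bigD1 i)//= indicE (negbTE yBi) mul0r.
rewrite mean_indic; last first.
  apply: fin_bigcap_measurable => [|i _]; [exact: finite_finset|exact: mI].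
rewrite indep//.
rewrite (_ : (\prod_(i in _) _)%E =
   (\prod_i mean P (fun t => \1_(B i) (y i t)))%:E)//.
rewrite -prodEFin; apply: eq_big => [i|i _]; first by rewrite finset.in_setT.
rewrite -(_ : \1_(y i @^-1` B i) = (fun t => \1_(B i) (y i t)))//.
by rewrite mean_indic// fineK// fin_num_measure.
Qed.

(** The indicators are replaced by arbitrary bounded functions one index at a
time: [s] lists the indices already treated. In the step for [k], the other
factors together form the fixed weight of [mean_mul_of_indic], and an event
determined by [f k] is again an event determined by [y k]. *)
Lemma mean_prod_aux (s : seq I) (f : I -> T' -> R) :
  (forall i, bmeas (f i)) ->
  (forall i, i \notin s -> exists2 B, measurable B & f i = \1_B) ->
  mean P (fun t => \prod_i f i (y i t)) =
  \prod_i mean P (fun t => f i (y i t)).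
Proof.
elim: s f => [|k s IH] f bf fB.
  have /choice[B BP] i : exists B, measurable B /\ f i = \1_B.
    by have [//|B mB fi] := fB i; exists B.
  have -> : f = fun i => \1_(B i) by apply/funext => i; have [] := BP i.
  by apply: mean_prod_indic => i; have [] := BP i.
(* With an indicator (or the constant 1) in position [k], the induction
   hypothesis applies. *)
pose upd (g : T' -> R) i := if i == k then g else f i.
have upd_prod (g : T' -> R) t : \prod_i upd g i (y i t) =
    g (y k t) * \prod_(i | i != k) f i (y i t).
  rewrite (bigD1 k)//= /upd eqxx; congr (_ * _).
  by apply: eq_bigr => i /negbTE ->.
have upd_mean (g : T' -> R) :
    \prod_i mean P (fun t => upd g i (y i t)) =
    mean P (fun t => g (y k t)) *
    \prod_(i | i != k) mean P (fun t => f i (y i t)).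
  rewrite (bigD1 k)//= /upd eqxx; congr (_ * _).
  by apply: eq_bigr => i /negbTE ->.
have IHupd (B : set T') : measurable B ->
    mean P (fun t => \1_B (y k t) * \prod_(i | i != k) f i (y i t)) =
    mean P (fun t => \1_B (y k t)) *
    \prod_(i | i != k) mean P (fun t => f i (y i t)).
  move=> mB; rewrite -upd_mean -IH.
  - by congr mean; apply/funext => t; rewrite upd_prod.
  - by move=> i; rewrite /upd; case: eqP => // _; exact: bmeas_indic.
  - move=> i is'; rewrite /upd; case: eqP => [_|/eqP ik]; first by exists B.
    by apply: fB; rewrite inE negb_or ik.
have meanW : mean P (fun t => \prod_(i | i != k) f i (y i t)) =
    \prod_(i | i != k) mean P (fun t => f i (y i t)).
  have := IHupd setT measurableT; rewrite indicT /= mean_cst mul1r => <-.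
  by congr mean; apply/funext => t; rewrite mul1r.
rewrite [RHS](bigD1 k)//= -meanW.
under [in LHS]eq_fun do rewrite (bigD1 k)//=.
apply: mean_mul_of_indic; first exact: bmeas_rv.
  by apply: bmeas_prod => i _; exact: bmeas_rv.
move=> B mB; rewrite meanW; apply: (IHupd (f k @^-1` B)).
rewrite -[X in measurable X]setTI; have [mf _] := bf k.
exact: mf measurableT _ mB.
Qed.

Lemma mean_prod (f : I -> T' -> R) : (forall i, bmeas (f i)) ->
  mean P (fun t => \prod_i f i (y i t)) =
  \prod_i mean P (fun t => f i (y i t)).
Proof.
by move=> bf; apply: (@mean_prod_aux (enum I)) => // i; rewrite mem_enum.
Qed.

(** Random variables known to be independent of the [y i] with [i] outside
[J]: finite linear combinations of products of bounded functions of the [y j]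
with [j] in [J]. This algebra replaces the sigma-algebra generated by those
[y j], and independence from it follows from [mean_prod] by linearity alone.
The scalar [c] makes all constants available, also when [J] is empty. *)
Inductive prod_span (J : pred I) : (T -> R) -> Prop :=
| prod_span_prod (c : R) (f : I -> T' -> R) of (forall i, bmeas (f i)) &
    (forall i, ~~ J i -> f i = fun=> 1) :
    prod_span J (fun t => c * \prod_i f i (y i t))
| prod_span_add (V W : T -> R) of prod_span J V & prod_span J W :
    prod_span J (fun t => V t + W t).

Section ProductSpan.
Variable J : pred I.

Lemma prod_span_bmeas W : prod_span J W -> bmeas W.
Proof.
elim=> [c f bf _|V {}W _ bV _ bW]; last exact: bmeasD.
by apply: bmeasZ; apply: bmeas_prod => i _; exact: bmeas_rv.
Qed.

Lemma prod_span_mul V W : prod_span J V -> prod_span J W ->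
  prod_span J (fun t => V t * W t).
Proof.
elim=> [c f bf f1|V1 V2 _ IH1 _ IH2] aW; last first.
  have -> : (fun t => (V1 t + V2 t) * W t) = fun t => V1 t * W t + V2 t * W t.
    by apply/funext => t; rewrite mulrDl.
  by apply: prod_span_add; auto.
elim: aW => [c' g bg g1|W1 W2 _ IH1 _ IH2]; last first.
  set U := fun t => c * \prod_i f i (y i t).
  have -> : (fun t => U t * (W1 t + W2 t)) = fun t => U t * W1 t + U t * W2 t.
    by apply/funext => t; rewrite mulrDr.
  exact: prod_span_add.
have -> : (fun t => c * (\prod_i f i (y i t)) * (c' * \prod_i g i (y i t))) =
    fun t => c * c' * \prod_i (fun v => f i v * g i v) (y i t).
  by apply/funext => t; rewrite big_split/= mulrACA.
apply: (prod_span_prod (c * c') (f := fun i v => f i v * g i v)) => [i|i Ji].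
  exact: bmeasM.
by rewrite f1// g1//; apply/funext => v; rewrite mulr1.
Qed.

Lemma prod_span_cst c : prod_span J (fun=> c).
Proof.
have -> : (fun=> c) = fun t => c * \prod_i (fun=> 1) (y i t).
  by apply/funext => t; rewrite big1_eq mulr1.
by apply: (prod_span_prod c (f := fun _ _ => 1)) => // i; exact: bmeas_cst.
Qed.

Lemma prod_span_coord j f : J j -> bmeas f -> prod_span J (fun t => f (y j t)).
Proof.
move=> Jj bf.
have -> : (fun t => f (y j t)) =
    fun t => 1 * \prod_i (if i == j then f else fun=> 1) (y i t).
  apply/funext => t; rewrite mul1r (bigD1 j)//= eqxx big1 ?mulr1//.
  by move=> i /negbTE ->.
apply: (prod_span_prod 1 (f := fun i => if i == j then f else fun=> 1)) => i.
  by case: eqP => // _; exact: bmeas_cst.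
by case: eqP => // ->; rewrite Jj.
Qed.

Lemma prod_span_sum (K : eqType) (s : seq K) (F : K -> T -> R) :
  (forall k, k \in s -> prod_span J (F k)) ->
  prod_span J (fun t => \sum_(k <- s) F k t).
Proof.
elim: s => [|k s IH] aF.
  have -> : (fun t => \sum_(k <- [::]) F k t) = fun=> 0.
    by apply/funext => t; rewrite big_nil.
  exact: prod_span_cst.
have -> : (fun t => \sum_(k <- k :: s) F k t) =
    fun t => F k t + \sum_(k <- s) F k t.
  by apply/funext => t; rewrite big_cons.
apply: prod_span_add; first by apply: aF; rewrite inE eqxx.
by apply: IH => j js; apply: aF; rewrite inE js orbT.
Qed.

Lemma mean_indep_prod_span i f W : ~~ J i -> bmeas f -> prod_span J W ->
  mean P (fun t => f (y i t) * W t) = mean P (fun t => f (y i t)) * mean P W.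
Proof.
move=> Ji bf; elim=> [c g bg g1|V1 V2 aV1 IH1 aV2 IH2]; last first.
  have bV1 := prod_span_bmeas aV1; have bV2 := prod_span_bmeas aV2.
  have bfy := bmeas_rv (y i) bf.
  rewrite meanD// mulrDr -IH1 -IH2 -meanD; [|exact: bmeasM..].
  by congr mean; apply/funext => t; rewrite mulrDr.
have bprod : bmeas (fun t => \prod_i g i (y i t)).
  by apply: bmeas_prod => j _; exact: bmeas_rv.
rewrite meanZ// mean_prod//.
pose h j := if j == i then f else g j.
have bh j : bmeas (h j) by rewrite /h; case: eqP.
have -> : (fun t => f (y i t) * (c * \prod_i g i (y i t))) =
    fun t => c * \prod_j h j (y j t).
  apply/funext => t; rewrite mulrCA; congr (_ * _).
  rewrite (bigD1 i)//= g1// mul1r [RHS](bigD1 i)//= /h eqxx; congr (_ * _).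
  by apply: eq_bigr => j /negbTE ->.
rewrite meanZ; last by apply: bmeas_prod => j _; exact: bmeas_rv.
rewrite mean_prod// mulrCA; congr (_ * _).
rewrite (bigD1 i)//= /h eqxx [in RHS](bigD1 i)//= g1// mean_cst mul1r.
by congr (_ * _); apply: eq_bigr => j /negbTE ->.
Qed.

End ProductSpan.
End Independence.

(** * Borel measurability of maps between matrix spaces *)

Section BorelRowVectors.
Context {R : realType}.

(** Finitely many coordinates have to be controlled simultaneously. *)
Lemma continuous_mx (U : topologicalType) m n (f : U -> 'M[R]_(m, n)) :
  (forall i j, continuous (fun u => f u i j)) -> continuous f.
Proof.
move=> cf u A [B uB BA]; rewrite /nbhs/=.
apply: filterS (_ : nbhs u [set x | forall i j, B i j (f x i j)]).
  by move=> x Bfx; apply: BA.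
apply: filter_forall => i; apply: filter_forall => j.
exact: (cf i j u _ (uB i j)).
Qed.

Lemma open_measurable_mx m n (A : set 'M[R]_(m, n)) : open A -> measurable A.
Proof. by move=> oA; apply: sub_sigma_algebra. Qed.

Lemma measurable_continuous_mx m n p q (f : 'M[R]_(m, n) -> 'M[R]_(p, q)) :
  continuous f -> measurable_fun setT f.
Proof.
move=> /continuousP cf; apply: (measurability (@open 'M[R]_(p, q)) erefl).
move=> _ [A oA <-]; rewrite setTI; apply: open_measurable_mx; exact: cf.
Qed.

Lemma measurable_coord m n i j :
  measurable_fun setT (fun v : 'M[R]_(m, n) => v i j).
Proof.
apply: (measurability _ (RGenOpens.measurableE R)).
move=> _ [_ [a [b ->] <-]]; rewrite setTI; apply: open_measurable_mx.
move: (@coord_continuous R m n i j) => /continuousP; apply.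
exact: interval_open.
Qed.

Lemma measurable_mulmxr n (Q : 'M[R]_n) :
  measurable_fun setT (fun w : 'rV[R]_n => w *m Q).
Proof.
apply: (@measurable_continuous_mx 1 n 1 n); apply: continuous_mx => i j w.
rewrite (_ : (fun u : 'rV[R]_n => _) =
    fun u : 'rV[R]_n => \sum_k u i k * Q k j); last first.
  by apply/funext => u; rewrite mxE.
have cM k : u i k * Q k j @[u --> w] --> w i k * Q k j.
  by apply: cvgM; [exact: coord_continuous | exact: cvg_cst].
exact: (cvg_big add_continuous _ (fun k _ => cM k)).
Qed.

Lemma measurable_scalemx n (r : R) :
  measurable_fun setT (fun w : 'rV[R]_n => r *: w).
Proof.
apply: (@measurable_continuous_mx 1 n 1 n); exact: scaler_continuous.
Qed.

End BorelRowVectors.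

(** * Means depend only on the law *)

Section EqLaw.
Context {d} {T : measurableType d} {R : realType} {P : probability T R}.
Context {d'} {T' : measurableType d'}.

Lemma mean_eq_law (X Y : {RV P >-> T'}) (g : T' -> R) :
  (forall A, measurable A -> distribution P X A = distribution P Y A) ->
  bmeas g -> mean P (fun t => g (X t)) = mean P (fun t => g (Y t)).
Proof.
move=> XY bg; have [mg _] := bg.
have E (Z : {RV P >-> T'}) : mean P (fun t => g (Z t)) =
    fine (\int[distribution P Z]_v (g v)%:E)%E.
  rewrite integral_distribution//; first exact/measurable_EFinP.
  exact: (bmeas_integrable P (bmeas_rv Z bg)).
rewrite !E; congr fine; apply: eq_measure_integral => A mA _; exact: XY.
Qed.
End EqLaw.

(** * Moments of a uniform point on a sphere *)

Section SphereMoments.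
Context {R : realType} {N : nat}.
Implicit Types (v : 'rV[R]_N) (r : R).

Definition normsq v : R := \sum_k v ord0 k ^+ 2.

Lemma enorm_sq v : enorm v ^+ 2 = normsq v.
Proof. by rewrite sqr_sqrtr// sumr_ge0// => k _; exact: sqr_ge0. Qed.

Lemma measurable_normsq : measurable_fun setT normsq.
Proof.
apply: measurable_sum => k; apply: measurable_funX; exact: measurable_coord.
Qed.

Lemma normsqZ r v : normsq (r *: v) = r ^+ 2 * normsq v.
Proof. by rewrite mulr_sumr; apply: eq_bigr => k _; rewrite mxE exprMn. Qed.

Lemma normsq_mulmx (Q : 'M[R]_N) v : Q *m Q^T = 1%:M ->
  normsq (v *m Q) = normsq v.
Proof.
have E w : normsq w = (w *m w^T) ord0 ord0.
  by rewrite mxE; apply: eq_bigr => k _; rewrite mxE expr2.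
by move=> QQ; rewrite !E trmx_mul mulmxA -(mulmxA v) QQ mulmx1.
Qed.

Variable e : 'I_N.

(** The [a]-th coordinate of [v], after points off the sphere of radius [r]
have been sent to [r] times the basis vector [e]. It equals [v ord0 a] almost
surely for a uniform point, but is bounded on the whole space and satisfies
[sphcoord_sum] without exception. *)
Definition sphcoord r (a : 'I_N) v : R :=
  if normsq v == r ^+ 2 then v ord0 a else r * (a == e)%:R.

Lemma sphcoordE r a v : normsq v = r ^+ 2 -> sphcoord r a v = v ord0 a.
Proof. by rewrite /sphcoord => ->; rewrite eqxx. Qed.

Lemma sphcoord_sum r v : \sum_a sphcoord r a v ^+ 2 = r ^+ 2.
Proof.
rewrite /sphcoord; have [/eqP//|_] := boolP (normsq v == r ^+ 2).
rewrite (bigD1 e)//= eqxx mulr1 big1 ?addr0// => i /negbTE ->.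
by rewrite mulr0 expr0n.
Qed.

Lemma bmeas_sphcoord r a : bmeas (sphcoord r a).
Proof.
split.
  apply: measurable_fun_ifT => //; last exact: measurable_coord.
  by apply: measurable_fun_eqr => //; exact: measurable_normsq.
exists `|r| => v.
have <- // := @ler_pXn2r R 2 isT `|sphcoord r a v| `|r|; rewrite ?nnegrE//.
rewrite !real_normK ?num_real//.
rewrite -(sphcoord_sum r v) (bigD1 a)//= lerDl sumr_ge0// => i _.
exact: sqr_ge0.
Qed.

Context {d} {T : measurableType d} {P : probability T R}.
Variables (r : R) (X : {RV P >-> 'rV[R]_N}).
Hypothesis unifX : uniform_on_sphere r X.

Lemma normsq_ae : {ae P, forall t, normsq (X t) = r ^+ 2}.
Proof.
have mS c : measurable [set v : 'rV[R]_N | normsq v = c].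
  rewrite -[X in measurable X]setTI.
  exact: (measurable_normsq measurableT (measurable_set1 c)).
have [mu [mu1 _] law] := unifX.
have sphereE : unit_sphere R N = [set v | normsq v = 1].
  apply/seteqP; split => w /=; first by rewrite -enorm_sq => ->; rewrite expr1n.
  by rewrite /unit_sphere /enorm /= -/(normsq w) => ->; rewrite sqrtr1.
have mX : measurable (X @^-1` [set v | normsq v = r ^+ 2]).
  exact: measurable_funPTI.
have mrS : measurable ((fun w : 'rV[R]_N => r *: w) @^-1`
    [set v | normsq v = r ^+ 2]).
  rewrite -[X in measurable X]setTI.
  exact: (measurable_scalemx r measurableT (mS (r ^+ 2))).
have PX : P (X @^-1` [set v | normsq v = r ^+ 2]) = 1%E.
  have := law _ (mS (r ^+ 2)); rewrite /distribution /pushforward /= => ->.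
  apply/eqP; rewrite eq_le probability_le1//= -mu1 sphereE.
  apply: le_measure; [exact: mem_set|exact: mem_set|].
  by move=> w /= w1; rewrite normsqZ w1 mulr1.
exists (~` (X @^-1` [set v | normsq v = r ^+ 2])); split => //.
- exact: measurableC.
- by have := probability_setC P mX; rewrite PX subee.
Qed.

Lemma law_mulmx (Q : 'M[R]_N) : Q *m Q^T = 1%:M ->
  forall A : set 'rV[R]_N, measurable A ->
    P ((fun t => X t *m Q) @^-1` A) = P (X @^-1` A).
Proof.
move=> QQ A mA; have [mu [_ inv] law] := unifX.
have mrA : measurable ((fun w : 'rV[R]_N => r *: w) @^-1` A).
  rewrite -[X in measurable X]setTI.
  exact: (measurable_scalemx r measurableT mA).
have mQA : measurable ((fun w : 'rV[R]_N => w *m Q) @^-1` A).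
  rewrite -[X in measurable X]setTI.
  exact: (measurable_mulmxr Q measurableT mA).
have := law _ mQA; rewrite /distribution /pushforward /= => ->.
have := law _ mA; rewrite /distribution /pushforward /= => ->.
rewrite -(inv _ QQ _ mrA); congr (mu _).
by apply/seteqP; split => w /=; rewrite scalemxAl.
Qed.

Lemma mean_mulmx (Q : 'M[R]_N) (g : 'rV[R]_N -> R) : Q *m Q^T = 1%:M ->
  bmeas g -> mean P (fun t => g (X t)) = mean P (fun t => g (X t *m Q)).
Proof.
move=> QQ bg.
have mXQ : measurable_fun setT (fun t => X t *m Q).
  by apply: (measurableT_comp (measurable_mulmxr Q)).
pose XQ : {RV P >-> 'rV[R]_N} :=
  HB.pack (fun t => X t *m Q) (isMeasurableFun.Build _ _ _ _ _ mXQ).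
by apply: (@mean_eq_law _ _ _ _ _ _ X XQ) => // A mA; rewrite [RHS]law_mulmx.
Qed.

Definition reflection (a : 'I_N) : 'M[R]_N :=
  diag_mx (\row_k (if k == a then -1 else 1)).

Lemma reflection_orth a : reflection a *m (reflection a)^T = 1%:M.
Proof.
rewrite tr_diag_mx mulmx_diag -diag_const_mx; congr diag_mx.
by apply/rowP => k; rewrite !mxE; case: eqP => _; rewrite ?mulrNN ?mulr1.
Qed.

Lemma reflectionE a b v : (v *m reflection a) ord0 b =
  (if b == a then -1 else 1) * v ord0 b.
Proof. by rewrite mul_mx_diag !mxE mulrC. Qed.

Lemma perm_orth (s : 'S_N) : perm_mx s *m (perm_mx s)^T = 1%:M :> 'M[R]_N.
Proof. by rewrite tr_perm_mx -perm_mxM mulgV perm_mx1. Qed.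

Lemma sphcoord_mulmx_ae (Q : 'M[R]_N) : Q *m Q^T = 1%:M ->
  {ae P, forall t, forall a,
    sphcoord r a (X t *m Q) = (X t *m Q) ord0 a /\
    sphcoord r a (X t) = X t ord0 a}.
Proof.
move=> QQ; apply: filterS normsq_ae => t Xt a.
by rewrite !sphcoordE// normsq_mulmx.
Qed.

Lemma bmeas_sphcoord_mulmx (Q : 'M[R]_N) a :
  bmeas (fun t => sphcoord r a (X t *m Q)).
Proof.
apply: (bmeas_comp (h := fun t => X t *m Q)); first exact: bmeas_sphcoord.
by apply: (measurableT_comp (measurable_mulmxr Q)).
Qed.

Let Y a t := sphcoord r a (X t).

Lemma bmeasY a : bmeas (Y a).
Proof. exact: (bmeas_rv X (bmeas_sphcoord r a)). Qed.

(** Negating coordinate [a] preserves the law of [X], so the mean equals its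
own opposite. *)
Lemma mean_sphcoord a : mean P (Y a) = 0.
Proof.
have bY := bmeasY a.
suff : mean P (Y a) = -1 * mean P (Y a) by lra.
rewrite -meanZ// {1}/Y (mean_mulmx (reflection_orth a) (bmeas_sphcoord r a)).
apply: ae_eq_mean.
- exact: bmeas_measurable (bmeas_sphcoord_mulmx _ a).
- exact: bmeas_measurable (bmeasZ _ bY).
- apply: filterS (sphcoord_mulmx_ae (reflection_orth a)) => t /(_ a)[-> +].
  by rewrite /Y => ->; rewrite reflectionE eqxx.
Qed.

(** Negating coordinate [a] alone changes the sign of the product. *)
Lemma mean_sphcoordM_neq a b : a != b -> mean P (fun t => Y a t * Y b t) = 0.
Proof.
move=> ab; have bY := bmeasM (bmeasY a) (bmeasY b).
suff : mean P (fun t => Y a t * Y b t) = -1 * mean P (fun t => Y a t * Y b t).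
  by lra.
rewrite -meanZ// {1}/Y (mean_mulmx (reflection_orth a)
  (bmeasM (bmeas_sphcoord r a) (bmeas_sphcoord r b))).
apply: ae_eq_mean.
- exact: bmeas_measurable
    (bmeasM (bmeas_sphcoord_mulmx _ a) (bmeas_sphcoord_mulmx _ b)).
- exact: bmeas_measurable (bmeasZ _ bY).
- apply: filterS (sphcoord_mulmx_ae (reflection_orth a)) => t H.
  have [-> Ea] := H a; have [-> Eb] := H b; rewrite /Y Ea Eb.
  by rewrite !reflectionE eqxx eq_sym (negbTE ab) mul1r mulrA.
Qed.

(** Exchanging two coordinates preserves the law, so the [N] second moments are
equal; they add up to [r ^+ 2]. *)
Lemma mean_sphcoord_sq a : mean P (fun t => Y a t ^+ 2) = r ^+ 2 / N%:R.
Proof.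
have bY b := bmeasM (bmeasY b) (bmeasY b).
have swap b : mean P (fun t => Y b t ^+ 2) = mean P (fun t => Y a t ^+ 2).
  have bX c := bmeasM (bmeas_sphcoord r c) (bmeas_sphcoord r c).
  rewrite [RHS](mean_mulmx (perm_orth (tperm a b)) (bX a)).
  apply: ae_eq_mean; first exact: bmeas_measurable (bY b).
    exact: bmeas_measurable
      (bmeasM (bmeas_sphcoord_mulmx _ a) (bmeas_sphcoord_mulmx _ a)).
  apply: filterS (sphcoord_mulmx_ae (perm_orth (tperm a b))) => t H.
  have [-> _] := H a; have [_ Eb] := H b; rewrite /Y Eb.
  have -> : (X t *m perm_mx (tperm a b)) ord0 a = X t ord0 b.
    by rewrite -{1}tpermV -col_permE mxE tpermL.
  by rewrite expr2.
have : \sum_b mean P (fun t => Y b t ^+ 2) = r ^+ 2.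
  rewrite -mean_sum => [|b]; last exact: bY.
  rewrite -[RHS](mean_cst P); congr mean; apply/funext => t.
  exact: sphcoord_sum.
under eq_bigr do rewrite swap.
rewrite sumr_const card_ord => <-; rewrite -(mulr_natr (mean _ _)).
by rewrite mulfK// pnatr_eq0 -lt0n (leq_ltn_trans _ (ltn_ord e)).
Qed.

End SphereMoments.

(** * Adding one vector to a sum *)

Section Recursion.
Context {dT} {T : measurableType dT} {R : realType} {P : probability T R}.
Context {N : nat} (e : 'I_N) {I : finType} (d : I -> R).
Variable y : I -> {RV P >-> 'rV[R]_N}.
Hypothesis indep : mutually_independent y.
Hypothesis unif : forall i, uniform_on_sphere (d i) (y i).

Let x i a t := sphcoord e (d i) a (y i t).
Let S s a t := \sum_(i <- s) x i a t.
Let q (s : seq I) := \sum_(i <- s) d i ^+ 2.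

(** The centred squared length: for a duplicate-free [s] it has mean 0, so its
second moment is the variance. *)
Definition excess (s : seq I) t := \sum_a (\sum_(i <- s) x i a t) ^+ 2 - q s.

Let mems (s : seq I) : pred I := fun i => i \in s.

Lemma prod_span_S s a : prod_span y (mems s) (S s a).
Proof.
apply: prod_span_sum => i si; apply: (@prod_span_coord _ _ _ _ _ _ _ _ _ i) => //.
exact: bmeas_sphcoord.
Qed.

Lemma prod_span_excess s : prod_span y (mems s) (excess s).
Proof.
apply: (@prod_span_add _ _ _ _ _ _ _ _ _ _ (fun=> - q s));
  last exact: prod_span_cst.
apply: prod_span_sum => a _.
have -> : (fun t => (\sum_(i <- s) x i a t) ^+ 2) = fun t => S s a t * S s a t.
  by apply/funext => t; rewrite expr2.
by apply: prod_span_mul; exact: prod_span_S.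
Qed.

Lemma excess_cons i s t : excess (i :: s) t =
  excess s t + 2 * \sum_a x i a t * S s a t.
Proof.
have sq : \sum_a (\sum_(j <- i :: s) x j a t) ^+ 2 =
    d i ^+ 2 + 2 * (\sum_a x i a t * S s a t) + \sum_a S s a t ^+ 2.
  rewrite -(sphcoord_sum e (d i) (y i t)) mulr_sumr -!big_split/=.
  by apply: eq_bigr => a _; rewrite big_cons sqrrD -mulr_natl.
by rewrite /excess sq /q big_cons; ring.
Qed.

(** Let [G] be the inner product of [x i] with the partial sum over [s], so that
the excess grows by [2 * G]. As [x i] is centred and independent of that partial
sum, [G] has mean 0 and is uncorrelated with the previous excess. Since [x i]
has covariance [d i ^+ 2 / N] times the identity, [G ^+ 2] has mean
[d i ^+ 2 / N] times the mean squared length of the partial sum, which is the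
sum of the squared radii. *)
Lemma excess_moments s : uniq s ->
  mean P (excess s) = 0 /\
  mean P (fun t => excess s t ^+ 2) =
    2 / N%:R * (q s ^+ 2 - \sum_(i <- s) d i ^+ 4).
Proof.
elim: s => [_|i s IH /= /andP[is_ us]].
  have -> : excess [::] = fun=> 0.
    apply/funext => t; rewrite /excess /q big_nil subr0 big1// => a _.
    by rewrite big_nil expr0n.
  by rewrite expr0n/= !mean_cst /q !big_nil expr0n subr0 mulr0.
have [E0 E2] := IH us.
have aS a := prod_span_S s a; have aD := prod_span_excess s.
have bS a := prod_span_bmeas (aS a); have bD := prod_span_bmeas aD.
have bx a : bmeas (x i a) := bmeas_rv (y i) (bmeas_sphcoord e (d i) a).
have x0 a W : prod_span y (mems s) W -> mean P (fun t => x i a t * W t) = 0.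
  move=> aW; rewrite (mean_indep_prod_span indep is_ (bmeas_sphcoord _ _ a) aW).
  by rewrite (mean_sphcoord e (unif i)) mul0r.
have bxS a := bmeasM (bx a) (bS a).
have bsum := bmeas_sum (index_enum 'I_N) (Q := predT) (fun a _ => bxS a).
have meanNormS : \sum_a mean P (fun t => S s a t * S s a t) = q s.
  rewrite -mean_sum => [|a]; last exact: bmeasM.
  transitivity (mean P (fun t => excess s t + q s)).
    congr mean; apply/funext => t; rewrite /excess subrK.
    by apply: eq_bigr => a _; rewrite expr2.
  by rewrite meanD ?E0 ?mean_cst ?add0r//; exact: bmeas_cst.
have meanG2 : mean P (fun t => (\sum_a x i a t * S s a t) ^+ 2) =
    d i ^+ 2 / N%:R * q s.
  have bxx a b := bmeasM (bxS a) (bxS b).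
  transitivity (mean P (fun t =>
      \sum_a \sum_b (x i a t * S s a t) * (x i b t * S s b t))).
    congr mean; apply/funext => t; rewrite expr2 mulr_suml.
    by apply: eq_bigr => a _; rewrite mulr_sumr.
  rewrite mean_sum => [|a]; last exact: bmeas_sum.
  rewrite -meanNormS mulr_sumr; apply: eq_bigr => a _.
  rewrite mean_sum//.
  have xxSS b : mean P (fun t => (x i a t * S s a t) * (x i b t * S s b t)) =
      mean P (fun t => x i a t * x i b t) * mean P (fun t => S s a t * S s b t).
    rewrite -(mean_indep_prod_span indep is_ (bmeasM (bmeas_sphcoord e (d i) a)
      (bmeas_sphcoord e (d i) b)) (prod_span_mul (aS a) (aS b))).
    by congr mean; apply/funext => t; rewrite mulrACA.
  under eq_bigr do rewrite xxSS.
  rewrite (bigD1 a)//= big1 ?addr0 => [|b ba].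
    congr (_ * _); rewrite -(mean_sphcoord_sq e (unif i) a).
    by congr mean; apply/funext => t; rewrite expr2.
  by rewrite (mean_sphcoordM_neq e (unif i)) ?mul0r// eq_sym.
have meanDG : mean P (fun t => excess s t * \sum_a x i a t * S s a t) = 0.
  transitivity (mean P (fun t => \sum_a x i a t * (excess s t * S s a t))).
    congr mean; apply/funext => t; rewrite mulr_sumr.
    by apply: eq_bigr => a _; rewrite mulrCA.
  rewrite mean_sum => [|a]; last exact: (bmeasM (bx a) (bmeasM bD (bS a))).
  by apply: big1 => a _; apply: x0; exact: prod_span_mul.
split.
  rewrite (funext (excess_cons i s)) meanD//; last exact: bmeasZ.
  rewrite meanZ// E0 add0r mean_sum// big1 ?mulr0// => a _; exact: x0.
transitivity (mean P (fun t => excess s t ^+ 2 +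
    (4 * (excess s t * \sum_a x i a t * S s a t) +
     4 * (\sum_a x i a t * S s a t) ^+ 2))).
  by congr mean; apply/funext => t; rewrite excess_cons; ring.
have bDG := bmeasM bD bsum; have bDD := bmeasM bD bD.
have bGG := bmeasM bsum bsum.
rewrite (meanD P bDD (bmeasD (bmeasZ 4 bDG) (bmeasZ 4 bGG))).
rewrite (meanD P (bmeasZ 4 bDG) (bmeasZ 4 bGG)) (meanZ P 4 bDG) (meanZ P 4 bGG).
rewrite E2 meanDG meanG2 /q !big_cons -/(q s).
by ring.
Qed.
End Recursion.

(** * Mean and variance of the squared length *)

Lemma sum_sqr_lt (R : comRingType) (M : nat) (u : 'I_M -> R) :
  (\sum_i u i) ^+ 2 - \sum_i u i ^+ 2 =
  2 * \sum_(i < M) \sum_(j < M | (i < j)%N) u i * u j.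
Proof.
have split_row i : \sum_j u i * u j = \sum_(j < M | (i < j)%N) u i * u j +
    (u i ^+ 2 + \sum_(j < M | (j < i)%N) u i * u j).
  rewrite (bigID (fun j : 'I_M => (i < j)%N))/=; congr (_ + _).
  rewrite (bigD1 i) ?ltnn//= -expr2; congr (_ + _).
  by apply: eq_bigl => j; rewrite -leqNgt ltn_neqAle andbC.
have swap : \sum_(i < M) \sum_(j < M | (j < i)%N) u i * u j =
    \sum_(i < M) \sum_(j < M | (i < j)%N) u i * u j.
  rewrite (exchange_big_dep predT)//=; apply: eq_bigr => i _.
  by apply: eq_bigr => j _; rewrite mulrC.
rewrite expr2 mulr_suml; under eq_bigr do rewrite mulr_sumr split_row.
by rewrite !big_split/= swap; ring.
Qed.

Theorem mainTheorem3 (R : realType) (disp : measure_display)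
    (T : measurableType disp) (P : probability T R)
    (N M : nat) (hN : (1 <= N)%N) (hM : (1 <= M)%N)
    (d : 'I_M -> R) (hd : forall i, 0 <= d i)
    (y : 'I_M -> {RV P >-> 'rV[R]_N})
    (hindep : mutually_independent y)
    (hunif : forall i, uniform_on_sphere (d i) (y i)) :
  let Z := fun t : T => enorm (\sum_(i < M) y i t) ^+ 2 in
  'E_P[Z]%E = (\sum_(i < M) d i ^+ 2)%:E /\
  (stdev P Z ^+ 2)%E =
    (4 / N%:R * \sum_(i < M) \sum_(j < M | (i < j)%N) d i ^+ 2 * d j ^+ 2)%:E.
Proof.
move=> Z; pose e : 'I_N := Ordinal hN.
pose q := \sum_(i < M) d i ^+ 2.
pose D := excess e d y (index_enum 'I_M).
have bD : bmeas D := prod_span_bmeas (prod_span_excess e d y _).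
have mZ : measurable_fun setT Z.
  have -> : Z = fun t => \sum_a (\sum_i y i t ord0 a) ^+ 2.
    apply/funext => t; rewrite /Z enorm_sq; apply: eq_bigr => a _.
    by rewrite summxE.
  apply: measurable_sum => a; apply: measurable_funX.
  apply: measurable_sum => i.
  exact: (measurableT_comp (measurable_coord _ _)).
have ZD : {ae P, forall t, Z t = D t + q}.
  have /filter_forall : forall i, {ae P, forall t, normsq (y i t) = d i ^+ 2}.
    by move=> i; exact: normsq_ae.
  apply: filterS => t Yt; rewrite /Z /D /excess subrK enorm_sq.
  apply: eq_bigr => a _; rewrite summxE; congr (_ ^+ 2).
  by apply: eq_bigr => i _; rewrite sphcoordE.
have [D0 D2] := excess_moments e hindep hunif (index_enum_uniq 'I_M).
have EZ : 'E_P[Z]%E = q%:E.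
  rewrite unlock.
  transitivity (\int[P]_t (D t + q)%:E)%E.
    apply: ae_eq_integral => //; first exact/measurable_EFinP.
      by apply/measurable_EFinP; apply: measurable_funD => //; case: bD.
    by apply: filterS ZD => t Zt _ /=; rewrite Zt.
  rewrite integral_mean; last by apply: bmeasD => //; exact: bmeas_cst.
  by rewrite meanD//; [rewrite D0 add0r mean_cst|exact: bmeas_cst].
split; first exact: EZ.
have VZ : 'V_P[Z]%E = (mean P (fun t => D t ^+ 2))%:E.
  rewrite /variance unlock EZ/= unlock -integral_mean;
    last exact: (bmeasM bD bD).
  apply: ae_eq_integral => //.
  - apply/measurable_EFinP; apply: measurable_funM; exact: measurable_funB.
  - by apply/measurable_EFinP; apply: measurable_funX; case: bD.
  - apply: filterS ZD => t Zt _ /=; rewrite /GRing.mul/=.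
    by rewrite Zt addrK expr2.
have V0 : (0 <= 'V_P[Z])%E by exact: variance_ge0.
rewrite /stdev sqr_sqrte// VZ D2 -/q; congr EFin.
have -> : \sum_i d i ^+ 4 = \sum_i (d i ^+ 2) ^+ 2.
  by apply: eq_bigr => i _; rewrite -exprM.
by rewrite sum_sqr_lt; ring.
Qed.
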